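(* Assume $q$ is not a root of unity. For every $d\in\mathbb N$, the $\mathcal A$-module $L(d)$ is irreducible.
   Context: $\mathbb K$ is a field and $q$ is a nonzero scalar in $\mathbb K$ that is not a root of unity (in particular $q^2\ne1$). $\mathbb N=\{0,1,2,\ldots\}$. $U_q(\mathfrak{sl}_2)$ is the unital associative $\mathbb K$-algebra with generators $x,y,y^{-1},z$ and relations $yy^{-1}=y^{-1}y=1$, $\frac{qxy-q^{-1}yx}{q-q^{-1}}=1$, $\frac{qyz-q^{-1}zy}{q-q^{-1}}=1$, $\frac{qzx-q^{-1}xz}{q-q^{-1}}=1$. $\mathcal A$ is the $\mathbb K$-subalgebra of $U_q(\mathfrak{sl}_2)$ spanned by $x^ry^sz^t$ with $r,s,t\in\mathbb N$ and $r+s+t$ even. For $d\in\mathbb N$ and $\epsilon\in\{1,-1\}$, $L(d,\epsilon)$ is the (known, irreducible) $U_q(\mathfrak{sl}_2)$-module with basis $\{u_i\}_{i=0}^d$ such that for $0\le i\le d$: $(\epsilon x-q^{d-2i})u_i=(q^{-d}-q^{d-2i+2})u_{i-1}$, $(\epsilon y-q^{d-2i})u_i=(q^d-q^{d-2i-2})u_{i+1}$, $\epsilon z u_i=q^{2i-d}u_i$, where $u_{-1}=u_{d+1}=0$. The restrictions to $\mathcal A$ of $L(d,1)$ and $L(d,-1)$ are isomorphic via $u_i\mapsto u_i$; identifying them, the resulting $\mathcal A$-module is denoted $L(d)$ (so $L(d)$ is $L(d,1)$ restricted to $\mathcal A$). *)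

(* Defs.v *)
From HB Require Import structures.
From mathcomp Require Import all_boot all_order all_algebra.
From mathcomp Require Import generic_quotient ring_quotient boolp.
From mathcomp Require Import monalg ring zify.

Set Implicit Arguments.
Unset Strict Implicit.
Unset Printing Implicit Defensive.

Import GRing.Theory Quotient.
Local Open Scope ring_scope.

Definition is_root_of_unity (K : fieldType) (q : K) : Prop :=
  exists2 n, (0 < n)%N & n.-unity_root q.

(* The two-sided ideal generated by S. *)
Inductive ideal_gen (R : nzRingType) (S : R -> Prop) : R -> Prop :=
| ideal_gen_in a : S a -> ideal_gen S a
| ideal_gen0 : ideal_gen S 0
| ideal_genD a b : ideal_gen S a -> ideal_gen S b -> ideal_gen S (a + b)
| ideal_genMl a b : ideal_gen S b -> ideal_gen S (a * b)
| ideal_genMr a b : ideal_gen S a -> ideal_gen S (a * b).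

Definition ideal_pred (R : nzRingType) (S : R -> Prop) : {pred R} :=
  fun a => `[< ideal_gen S a >].

Fact ideal_zmod_closed (R : nzRingType) (S : R -> Prop) :
  zmod_closed (ideal_pred S).
Proof.
split=> [|a b]; first exact/asboolP/ideal_gen0.
move=> /asboolP Ia /asboolP Ib; apply/asboolP.
by rewrite -mulN1r; apply/ideal_genD/ideal_genMl.
Qed.

HB.instance Definition _ (R : nzRingType) (S : R -> Prop) :=
  GRing.isZmodClosed.Build R (ideal_pred S) (ideal_zmod_closed S).


Definition in_span (K : pzRingType) (V : lmodType K) (S : V -> Prop) (v : V) :=
  exists s : seq (K * V),
    (forall p, p \in s -> S p.2) /\ v = \sum_(p <- s) p.1 *: p.2.

Section Span.
Context {K : pzRingType} {V : lmodType K}.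
Implicit Types (S : V -> Prop) (u v : V).

Lemma span_in S v : S v -> in_span S v.
Proof.
exists [:: (1, v)]; split=> [p|]; first by rewrite inE => /eqP->.
by rewrite big_seq1 scale1r.
Qed.

Lemma span0 S : in_span S 0.
Proof. by exists [::]; rewrite big_nil. Qed.

Lemma spanD S u v : in_span S u -> in_span S v -> in_span S (u + v).
Proof.
move=> [s [sS ->]] [t [tS ->]]; exists (s ++ t); split; last by rewrite big_cat.
by move=> p; rewrite mem_cat => /orP[/sS|/tS].
Qed.

Lemma spanZ S (c : K) v : in_span S v -> in_span S (c *: v).
Proof.
move=> [s [sS ->]]; exists [seq (c * p.1, p.2) | p <- s]; split.
  by move=> p /mapP[r rs ->]; exact: (sS r).
by rewrite big_map scaler_sumr; apply: eq_bigr => p _; rewrite scalerA.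
Qed.

End Span.

Lemma span_map (K : pzRingType) (V V' : lmodType K) (S : V -> Prop)
    (T : V' -> Prop) (f : V -> V') :
  f 0 = 0 -> {morph f : u v / u + v} -> (forall c u, f (c *: u) = c *: f u) ->
  (forall u, S u -> in_span T (f u)) -> forall u, in_span S u -> in_span T (f u).
Proof.
move=> f0 fD fZ fS u [s [sS ->]]; rewrite (big_morph f fD f0) big_seq.
apply: (big_ind (in_span T)) => [||p ps]; [exact: span0|exact: spanD|].
by rewrite fZ; apply/spanZ/fS/sS.
Qed.

Section QuotientAlgebra.
Variables (K : fieldType) (F : algType K) (S : F -> Prop).
Hypothesis S_proper : ~ ideal_gen S 1.

(* The quotient of F by the two-sided ideal generated by S; the properness
   hypothesis is what makes it a nonzero ring, as algType requires. *)
Definition quot_alg of ~ ideal_gen S 1 : Type := {quot (ideal_pred S)}.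
Local Notation A := (quot_alg S_proper).
Local Notation Q := {quot (ideal_pred S)}.

HB.instance Definition _ := GRing.Zmodule.on A.

Definition quot_proj (f : F) : A := (\pi_Q f)%qT.
Definition quot_repr (a : A) : F := repr (a : Q).

Lemma quot_projP f g : quot_proj f = quot_proj g <-> ideal_gen S (f - g).
Proof.
rewrite /quot_proj; split=> [/eqP|I].
  by rewrite -idealrBE => /asboolP.
by apply/eqP; rewrite -idealrBE; apply/asboolP.
Qed.

Lemma quot_reprK a : quot_proj (quot_repr a) = a. Proof. exact: reprK. Qed.

Lemma quot_projD f g : quot_proj (f + g) = quot_proj f + quot_proj g.
Proof. exact: pi_add. Qed.

Lemma quot_proj0 : quot_proj 0 = 0.
Proof. by apply: (addrI (quot_proj 0)); rewrite -quot_projD !addr0. Qed.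

Lemma quot_repr_proj f : ideal_gen S (quot_repr (quot_proj f) - f).
Proof. exact/quot_projP/quot_reprK. Qed.

Definition quot_one : A := quot_proj 1.
Definition quot_mul (a b : A) : A := quot_proj (quot_repr a * quot_repr b).
Definition quot_scale (c : K) (a : A) : A := quot_proj (c *: quot_repr a).

Let projM f g : quot_mul (quot_proj f) (quot_proj g) = quot_proj (f * g).
Proof.
apply/quot_projP; set f' := quot_repr _; set g' := quot_repr _.
have -> : f' * g' - f * g = (f' - f) * g' + f * (g' - g).
  by rewrite mulrBl mulrBr addrA subrK.
apply: ideal_genD; first exact/ideal_genMr/quot_repr_proj.
exact/ideal_genMl/quot_repr_proj.
Qed.

Let projZ c f : quot_scale c (quot_proj f) = quot_proj (c *: f).
Proof.
apply/quot_projP; rewrite -scalerBr -mulr_algl.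
exact/ideal_genMl/quot_repr_proj.
Qed.

Let projE := (projM, projZ, =^~ quot_projD).
Let proj_surj (a : A) : exists f, a = quot_proj f.
Proof. by exists (quot_repr a); rewrite quot_reprK. Qed.

Fact quot_mulA : associative quot_mul.
Proof.
move=> a b c; case: (proj_surj a) (proj_surj b) (proj_surj c).
by move=> f -> [g ->] [h ->]; rewrite !projE mulrA.
Qed.

Fact quot_mul1l : left_id quot_one quot_mul.
Proof. by move=> a; case: (proj_surj a) => f ->; rewrite !projE mul1r. Qed.

Fact quot_mul1r : right_id quot_one quot_mul.
Proof. by move=> a; case: (proj_surj a) => f ->; rewrite !projE mulr1. Qed.

Fact quot_mulDl : left_distributive quot_mul +%R.
Proof.
move=> a b c; case: (proj_surj a) (proj_surj b) (proj_surj c).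
by move=> f -> [g ->] [h ->]; rewrite !projE mulrDl.
Qed.

Fact quot_mulDr : right_distributive quot_mul +%R.
Proof.
move=> a b c; case: (proj_surj a) (proj_surj b) (proj_surj c).
by move=> f -> [g ->] [h ->]; rewrite !projE mulrDr.
Qed.

Fact quot_one_neq0 : quot_one != 0.
Proof. by apply/eqP; rewrite -quot_proj0 => /quot_projP; rewrite subr0. Qed.

HB.instance Definition _ := GRing.Zmodule_isNzRing.Build A
  quot_mulA quot_mul1l quot_mul1r quot_mulDl quot_mulDr quot_one_neq0.

Fact quot_scaleA c c' a : quot_scale c (quot_scale c' a) = quot_scale (c * c') a.
Proof. by case: (proj_surj a) => f ->; rewrite !projE scalerA. Qed.

Fact quot_scale1 : left_id 1 quot_scale.
Proof. by move=> a; case: (proj_surj a) => f ->; rewrite !projE scale1r. Qed.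

Fact quot_scaleDr : right_distributive quot_scale +%R.
Proof.
move=> c a b; case: (proj_surj a) (proj_surj b) => f -> [g ->].
by rewrite !projE scalerDr.
Qed.

Fact quot_scaleDl a : {morph quot_scale^~ a : c c' / c + c'}.
Proof. by move=> c c'; case: (proj_surj a) => f ->; rewrite !projE scalerDl. Qed.

HB.instance Definition _ := GRing.Zmodule_isLmodule.Build K A
  quot_scaleA quot_scale1 quot_scaleDr quot_scaleDl.

Lemma quot_projM f g : quot_proj (f * g) = quot_proj f * quot_proj g.
Proof. exact: esym (projM f g). Qed.

Lemma quot_projZ c f : quot_proj (c *: f) = c *: quot_proj f.
Proof. exact: esym (projZ c f). Qed.

Lemma quot_projB f g : quot_proj (f - g) = quot_proj f - quot_proj g.
Proof. by rewrite quot_projD -scaleN1r quot_projZ scaleN1r. Qed.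

Fact quot_scaleAl (c : K) (a b : A) : c *: (a * b) = c *: a * b.
Proof.
case: (proj_surj a) (proj_surj b) => f -> [g ->].
by rewrite -quot_projM -!quot_projZ -quot_projM scalerAl.
Qed.

HB.instance Definition _ := GRing.Lmodule_isLalgebra.Build K A quot_scaleAl.

Fact quot_scaleAr (c : K) (a b : A) : c *: (a * b) = a * (c *: b).
Proof.
case: (proj_surj a) (proj_surj b) => f -> [g ->].
by rewrite -quot_projM -!quot_projZ -quot_projM scalerAr.
Qed.

HB.instance Definition _ := GRing.Lalgebra_isAlgebra.Build K A quot_scaleAr.
End QuotientAlgebra.

Section QuotientLift.
Variables (K : fieldType) (F : algType K) (S : F -> Prop).
Hypothesis S_proper : ~ ideal_gen S 1.
Variables (B : algType K) (phi : F -> B).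
Hypotheses (phiB : {morph phi : f g / f - g}).
Hypotheses (phiM : {morph phi : f g / f * g}) (phi1 : phi 1 = 1).
Hypotheses (phiZ : forall c f, phi (c *: f) = c *: phi f).
Hypothesis phiS : forall f, ideal_gen S f -> phi f = 0.

Definition quot_lift (a : quot_alg S_proper) : B := phi (quot_repr a).

Lemma quot_lift_proj f : quot_lift (quot_proj S_proper f) = phi f.
Proof. by apply/eqP; rewrite -subr_eq0 -phiB phiS //; apply: quot_repr_proj. Qed.

Let proj_surj a : exists f, a = quot_proj S_proper f.
Proof. by exists (quot_repr a); rewrite quot_reprK. Qed.

Lemma quot_liftB : {morph quot_lift : a b / a - b}.
Proof.
move=> a b; have [[f ->] [g ->]] := (proj_surj a, proj_surj b).
by rewrite -quot_projB !quot_lift_proj phiB.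
Qed.

Lemma quot_liftM : {morph quot_lift : a b / a * b}.
Proof.
move=> a b; have [[f ->] [g ->]] := (proj_surj a, proj_surj b).
by rewrite -quot_projM !quot_lift_proj phiM.
Qed.

Lemma quot_lift1 : quot_lift 1 = 1.
Proof. exact: etrans (quot_lift_proj 1) phi1. Qed.

Lemma quot_liftZ c a : quot_lift (c *: a) = c *: quot_lift a.
Proof.
by have [f ->] := proj_surj a; rewrite -quot_projZ !quot_lift_proj phiZ.
Qed.
End QuotientLift.

(* Only for the unifier: these unfold into finitely supported functions. *)
#[global] Opaque quot_proj quot_repr quot_one quot_mul quot_scale quot_lift.

Section RepresentationModule.
Variables (R : nzRingType) (K : fieldType) (n : nat).

(* Column vectors, on which a acts by v |-> rho a *m v. *)
Definition rep_module of {rmorphism R -> 'M[K]_n.+1} : Type := 'cV[K]_n.+1.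

Variable rho : {rmorphism R -> 'M[K]_n.+1}.

HB.instance Definition _ := GRing.Zmodule.on (rep_module rho).

Definition rep_scale (a : R) (v : rep_module rho) : rep_module rho :=
  rho a *m (v : 'cV_n.+1).

Fact rep_scaleA a b v : rep_scale a (rep_scale b v) = rep_scale (a * b) v.
Proof. by rewrite /rep_scale rmorphM mulmxA. Qed.

Fact rep_scale1 : left_id 1 rep_scale.
Proof. by move=> v; rewrite /rep_scale rmorph1 mul1mx. Qed.

Fact rep_scaleDr : right_distributive rep_scale +%R.
Proof. by move=> a u v; apply: mulmxDr. Qed.

Fact rep_scaleDl v : {morph rep_scale^~ v : a b / a + b}.
Proof. by move=> a b; rewrite /rep_scale raddfD mulmxDl. Qed.

HB.instance Definition _ := GRing.Zmodule_isLmodule.Build R (rep_module rho)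
  rep_scaleA rep_scale1 rep_scaleDr rep_scaleDl.

Lemma rep_scaleE a (v : rep_module rho) : a *: v = rho a *m (v : 'cV_n.+1).
Proof. by []. Qed.
End RepresentationModule.

Section Restriction.
Variables (S R : nzRingType).

Definition restr_scalars of {rmorphism S -> R} := fun M : lmodType R => M : Type.

Variables (f : {rmorphism S -> R}) (M : lmodType R).
Local Notation N := (restr_scalars f M).

HB.instance Definition _ := GRing.Zmodule.on N.

Definition restr_scale (a : S) (v : N) : N := f a *: (v : M).

Fact restr_scaleA a b v : restr_scale a (restr_scale b v) = restr_scale (a * b) v.
Proof. by rewrite /restr_scale rmorphM scalerA. Qed.

Fact restr_scale1 : left_id 1 restr_scale.
Proof. by move=> v; rewrite /restr_scale rmorph1 scale1r. Qed.

Fact restr_scaleDr : right_distributive restr_scale +%R.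
Proof. by move=> a u v; apply: scalerDr. Qed.

Fact restr_scaleDl v : {morph restr_scale^~ v : a b / a + b}.
Proof. by move=> a b; rewrite /restr_scale raddfD scalerDl. Qed.

HB.instance Definition _ := GRing.Zmodule_isLmodule.Build S N
  restr_scaleA restr_scale1 restr_scaleDr restr_scaleDl.

Lemma restr_scaleE a (v : N) : a *: v = f a *: (v : M) :> M.
Proof. by []. Qed.
End Restriction.

(* A subset is a {pred M}, i.e. boolean-valued; with the classical axioms of
   boolp, on which the construction of L below relies anyway, every subset of M
   is of this form. When R is a unital K-algebra, submod_closed W contains
   closure under K-scaling. *)
Definition irreducible_module (R : nzRingType) (M : lmodType R) : Prop :=
  (exists v : M, v != 0) /\
  forall W : {pred M}, submod_closed W ->
    (forall v, v \in W -> v = 0) \/ (forall v, v \in W).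

(* The free unital associative algebra on four generators, the algebra of the
   free monoid on 'I_4; gen 0, 1, 2, 3 stand for x, y, y^-1, z. *)
Definition free_alg (K : fieldType) : Type := {malg K[{fmonom 'I_4}]}.

HB.instance Definition _ (K : fieldType) := GRing.Lalgebra.on (free_alg K).

Fact free_scalerAr (K : fieldType) (c : K) (f g : free_alg K) :
  c *: (f * g) = f * (c *: g).
Proof.
suff Z (h : {malg K[{fmonom 'I_4}]}) : c%:MP * h = h * c%:MP.
  by rewrite -(mul_malgC c g) mulrA -(Z f) -mulrA mul_malgC.
rewrite malgM_def [RHS]malgM_def fgmulUg fgmulgU; apply: eq_bigr => k _.
by rewrite mul1m mulm1 mulrC.
Qed.

HB.instance Definition _ (K : fieldType) :=
  GRing.Lalgebra_isAlgebra.Build K (free_alg K) (@free_scalerAr K).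

Section FreeAlg.
Variable K : fieldType.
Implicit Types f g : free_alg K.

Definition gen (i : 'I_4) : free_alg K := (<< fmu i >> : {malg K[_]}).

Section Eval.
Variables (n : nat) (G : 'I_4 -> 'M[K]_n.+1).

Definition word_eval (m : {fmonom 'I_4}) : 'M[K]_n.+1 := \prod_(i <- m) G i.

Fact word_eval_mmorphism : mmorphism word_eval.
Proof.
by split=> [m1 m2|]; rewrite /word_eval ?fmM ?fm1 ?big_cat ?big_nil.
Qed.

HB.instance Definition _ :=
  monalg.isMultiplicative.Build {fmonom 'I_4} 'M[K]_n.+1 word_eval
    word_eval_mmorphism.

Definition free_eval : free_alg K -> 'M[K]_n.+1 := mmap scalar_mx word_eval.

Lemma free_eval_gen i : free_eval (gen i) = G i.
Proof.
by rewrite /free_eval mmapU /word_eval fmuE big_seq1 mul1r.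
Qed.

Lemma free_evalD f g : free_eval (f + g) = free_eval f + free_eval g.
Proof. exact: mmapD. Qed.

Lemma free_evalB f g : free_eval (f - g) = free_eval f - free_eval g.
Proof. exact: mmapB. Qed.

Lemma free_evalZ (c : K) f : free_eval (c *: f) = c *: free_eval f.
Proof. by rewrite /free_eval mmapZ /= -mul_scalar_mx. Qed.

Lemma free_eval1 : free_eval 1 = 1.
Proof. exact: mmap1. Qed.

Lemma free_evalM f g : free_eval (f * g) = free_eval f * free_eval g.
Proof.
apply: (@commr_mmap_is_multiplicative _ _ _ _ _ _).1 => h m m'.
exact: comm_scalar_mx.
Qed.

Lemma free_eval_ideal (S : free_alg K -> Prop) f :
  (forall g, S g -> free_eval g = 0) -> ideal_gen S f -> free_eval f = 0.
Proof.
move=> S0; elim=> {f} [f /S0//||f g _ f0 _ g0|f g _ g0|f g _ f0].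
- exact: mmap0.
- by rewrite free_evalD f0 g0 addr0.
- by rewrite free_evalM g0 mulr0.
- by rewrite free_evalM f0 mul0r.
Qed.
End Eval.
End FreeAlg.

Section Uq_relations.
Variables (K : fieldType) (q : K).

Local Notation X := (gen K (@Ordinal 4 0 isT)).
Local Notation Y := (gen K (@Ordinal 4 1 isT)).
Local Notation Yi := (gen K (@Ordinal 4 2 isT)).
Local Notation Z := (gen K (@Ordinal 4 3 isT)).

(* (q ab - q^-1 ba) / (q - q^-1) *)
Definition qcomm (A : lalgType K) (a b : A) : A :=
  (q - q^-1)^-1 *: (q *: (a * b) - q^-1 *: (b * a)).

Inductive Uq_rel : free_alg K -> Prop :=
| Uq_rel_yyi : Uq_rel (Y * Yi - 1)
| Uq_rel_yiy : Uq_rel (Yi * Y - 1)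
| Uq_rel_xy : Uq_rel (qcomm X Y - 1)
| Uq_rel_yz : Uq_rel (qcomm Y Z - 1)
| Uq_rel_zx : Uq_rel (qcomm Z X - 1).

Definition gens4 (R : Type) (x y yi z : R) (i : 'I_4) : R :=
  nth x [:: x; y; yi; z] i.

Lemma qcomm_morph (A B : lalgType K) (f : A -> B) :
  {morph f : a b / a - b} -> (forall c a, f (c *: a) = c *: f a) ->
  {morph f : a b / a * b} -> {morph f : a b / qcomm a b}.
Proof. by move=> fB fZ fM a b; rewrite /qcomm !(fB, fZ, fM). Qed.

Lemma free_eval_qcomm n (G : 'I_4 -> 'M[K]_n.+1) a b :
  free_eval G (qcomm a b) = qcomm (free_eval G a) (free_eval G b).
Proof.
apply: qcomm_morph; [exact: free_evalB|exact: free_evalZ|exact: free_evalM].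
Qed.

Lemma free_eval_Uq_rel n (x y yi z : 'M[K]_n.+1) f :
    y * yi = 1 -> yi * y = 1 -> qcomm x y = 1 -> qcomm y z = 1 ->
    qcomm z x = 1 ->
  ideal_gen Uq_rel f -> free_eval (gens4 x y yi z) f = 0.
Proof.
move=> yyi yiy xy yz zx; set G := gens4 x y yi z.
have sub0 g : free_eval G g = 1 -> free_eval G (g - 1) = 0.
  by move=> g1; rewrite free_evalB g1 free_eval1 subrr.
apply: free_eval_ideal => _ []; apply: sub0.
- by rewrite free_evalM !free_eval_gen.
- by rewrite free_evalM !free_eval_gen.
- by rewrite free_eval_qcomm !free_eval_gen.
- by rewrite free_eval_qcomm !free_eval_gen.
- by rewrite free_eval_qcomm !free_eval_gen.
Qed.
End Uq_relations.

Section EvenSpan.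
Variables (K : fieldType) (q : K) (A : algType K) (x y z : A).
Hypotheses (q_neq0 : q != 0) (qqi0 : q - q^-1 != 0).
Hypotheses (xy1 : qcomm q x y = 1) (yz1 : qcomm q y z = 1).
Hypothesis (zx1 : qcomm q z x = 1).

Definition even_monomial (a : A) : Prop :=
  exists r s t : nat, ~~ odd (r + s + t) /\ a = x ^+ r * y ^+ s * z ^+ t.

Definition even_span : {pred A} := fun a => `[< in_span even_monomial a >].

Let mono (r s t : nat) : A := x ^+ r * y ^+ s * z ^+ t.
Let S (b : bool) (a : A) : Prop :=
  exists r s t : nat, odd (r + s + t) = b /\ a = mono r s t.
Let P b := in_span (S b).

Let spanMr (b b' : bool) (g : A) :
  (forall a, S b a -> P b' (a * g)) -> forall a, P b a -> P b' (a * g).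
Proof.
move=> h; apply: span_map h; first exact: mul0r.
  by move=> u v; rewrite mulrDl.
by move=> c u; rewrite scalerAl.
Qed.

Let qcomm_swapl (a b : A) : qcomm q a b = 1 ->
  exists c e : K, b * a = c *: (a * b) + e *: 1.
Proof.
move=> ab; exists (q ^+ 2), (1 - q ^+ 2).
have: (q * (q - q^-1)) *: qcomm q a b = (q * (q - q^-1)) *: 1 by rewrite ab.
rewrite /qcomm scalerA -mulrA divff ?qqi0 // mulr1 scalerBr !scalerA.
rewrite -expr2 divff // scale1r mulrBr divff // => /eqP.
rewrite subr_eq addrC -subr_eq => /eqP <-.
by rewrite -expr2 -scaleNr opprB.
Qed.

Let qcomm_swapr (a b : A) : qcomm q a b = 1 ->
  exists c e : K, a * b = c *: (b * a) + e *: 1.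
Proof.
move=> ab; exists (q ^- 2), (1 - q ^- 2).
have: (q^-1 * (q - q^-1)) *: qcomm q a b = (q^-1 * (q - q^-1)) *: 1 by rewrite ab.
rewrite /qcomm scalerA -mulrA divff ?qqi0 // mulr1 scalerBr !scalerA.
rewrite mulVf // scale1r mulrBr mulVf // -expr2 exprVn => /eqP.
by rewrite subr_eq addrC => /eqP.
Qed.

Let PMz b a : P b a -> P (~~ b) (a * z).
Proof.
apply: spanMr => _ [r [s [t [<- ->]]]]; apply: span_in.
by exists r, s, t.+1; rewrite addnS /= /mono exprSr mulrA.
Qed.

Let PMz_step (g : A) :
    (exists c e : K, z * g = c *: (g * z) + e *: 1) ->
    (forall r s, P (~~ odd (r + s)) (x ^+ r * y ^+ s * g)) ->
  forall b a, P b a -> P (~~ b) (a * g).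
Proof.
move=> [c [e zg]] g0 b; apply: spanMr => _ [r [s [t [<- ->]]]].
elim: t => [|t IHt]; first by rewrite addn0 /mono expr0 mulr1.
have -> : mono r s t.+1 * g = c *: (mono r s t * g * z) + e *: mono r s t.
  rewrite {1}/mono exprSr mulrA -mulrA zg mulrDr -!scalerAr mulr1.
  by rewrite /mono !mulrA.
rewrite addnS /= negbK; apply: spanD; apply: spanZ.
  by rewrite -[odd _]negbK; apply: PMz.
by apply: span_in; exists r, s, t.
Qed.

Let PMy b a : P b a -> P (~~ b) (a * y).
Proof.
apply: PMz_step; first exact/qcomm_swapl/yz1.
move=> r s; apply: span_in; exists r, s.+1, 0%N.
by rewrite addn0 addnS /mono expr0 mulr1 exprSr mulrA.
Qed.

Let PMx b a : P b a -> P (~~ b) (a * x).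
Proof.
apply: PMz_step; first exact/qcomm_swapr/zx1.
move=> r; elim=> [|s IHs].
  apply: span_in; exists r.+1, 0%N, 0%N.
  by rewrite !addn0 /mono !expr0 !mulr1 exprSr.
have [c [e yx]] := qcomm_swapl xy1.
have -> : x ^+ r * y ^+ s.+1 * x =
    c *: (x ^+ r * y ^+ s * x * y) + e *: mono r s 0.
  rewrite exprSr mulrA -mulrA yx mulrDr -!scalerAr mulr1.
  by rewrite /mono expr0 mulr1 !mulrA.
rewrite addnS /= negbK; apply: spanD; apply: spanZ.
  by rewrite -[odd _]negbK; apply: PMy.
by apply: span_in; exists r, s, 0%N; rewrite addn0.
Qed.

Let PMX (g : A) : (forall b a, P b a -> P (~~ b) (a * g)) ->
  forall n b a, P b a -> P (b (+) odd n) (a * g ^+ n).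
Proof.
move=> Pg; elim=> [|n IHn] b a Pa; first by rewrite mulr1 addbF.
by rewrite exprSr mulrA /= addbN; apply/Pg/IHn.
Qed.

Let PMM b b' a a' : P b a -> P b' a' -> P (b (+) b') (a * a').
Proof.
move=> Pa; apply: span_map => [|u v|c u|_ [r [s [t [<- ->]]]]].
- exact: mulr0.
- exact: mulrDr.
- by rewrite scalerAr.
- by rewrite !oddD !addbA !mulrA; do !apply: PMX => //.
Qed.

Let even_spanP a : a \in even_span <-> P false a.
Proof.
rewrite unfold_in; split=> [/asboolP|Pa]; last apply/asboolP;
  [move=> Pa | ]; apply: (span_map (f := id)) Pa => // _ [r [s [t [o ->]]]];
  apply: span_in; exists r, s, t; split=> //; [exact/negbTE | by rewrite o].
Qed.

Fact even_span_subalg_closed : subalg_closed even_span.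
Proof.
split=> [|c a b|a b].
- by apply/even_spanP/span_in; exists 0%N, 0%N, 0%N; rewrite /mono !mulr1.
- by move=> /even_spanP Pa /even_spanP Pb; apply/even_spanP/spanD => //; apply: spanZ.
- by move=> /even_spanP Pa /even_spanP Pb; apply/even_spanP/(PMM Pa Pb).
Qed.
End EvenSpan.

Section Uq.
Variables (K : fieldType) (q : K).
Hypotheses (q_neq0 : q != 0) (q_nroot : ~ is_root_of_unity q).

Lemma qn_neq1 n : (0 < n)%N -> q ^+ n != 1.
Proof.
move=> n0; apply/negP => qn; apply: q_nroot.
by exists n => //; apply/unity_rootP/eqP.
Qed.

Lemma qqi_neq0 : q - q^-1 != 0.
Proof.
apply: contra (qn_neq1 (isT : 0 < 2)%N); rewrite subr_eq0 => /eqP qE.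
by rewrite expr2 {1}qE mulVf.
Qed.

Lemma Uq_rel_proper : ~ ideal_gen (Uq_rel q) 1.
Proof.
move=> I1.
have qc : @qcomm K q 'M[K]_1 1 1 = 1.
  by rewrite /qcomm mulr1 -scalerBl scalerA mulVf ?qqi_neq0 // scale1r.
have := free_eval_Uq_rel (mulr1 1) (mulr1 1) qc qc qc I1.
by rewrite free_eval1 => /eqP; rewrite oner_eq0.
Qed.

(* U_q(sl_2) in the equitable presentation. *)
Definition Uq : Type := quot_alg Uq_rel_proper.
Local Notation U := Uq.

HB.instance Definition _ := GRing.Algebra.on U.

Definition Ux : U := quot_proj Uq_rel_proper (gen K (@Ordinal 4 0 isT)).
Definition Uy : U := quot_proj Uq_rel_proper (gen K (@Ordinal 4 1 isT)).
Definition Uyi : U := quot_proj Uq_rel_proper (gen K (@Ordinal 4 2 isT)).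
Definition Uz : U := quot_proj Uq_rel_proper (gen K (@Ordinal 4 3 isT)).

Let proj_qcomm f g : quot_proj Uq_rel_proper (qcomm q f g) =
  qcomm q (quot_proj Uq_rel_proper f) (quot_proj Uq_rel_proper g).
Proof.
apply: qcomm_morph f g => [f g|c f|f g].
- exact: quot_projB.
- exact: quot_projZ.
- exact: quot_projM.
Qed.

Lemma Uyyi : Uy * Uyi = 1.
Proof.
apply: etrans (esym (quot_projM _ _ _)) _.
exact/quot_projP/ideal_gen_in/Uq_rel_yyi.
Qed.

Lemma Uyiy : Uyi * Uy = 1.
Proof.
apply: etrans (esym (quot_projM _ _ _)) _.
exact/quot_projP/ideal_gen_in/Uq_rel_yiy.
Qed.

Lemma Uxy : qcomm q Ux Uy = 1.
Proof.
apply: etrans (esym (proj_qcomm _ _)) _.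
exact/quot_projP/ideal_gen_in/Uq_rel_xy.
Qed.

Lemma Uyz : qcomm q Uy Uz = 1.
Proof.
apply: etrans (esym (proj_qcomm _ _)) _.
exact/quot_projP/ideal_gen_in/Uq_rel_yz.
Qed.

Lemma Uzx : qcomm q Uz Ux = 1.
Proof.
apply: etrans (esym (proj_qcomm _ _)) _.
exact/quot_projP/ideal_gen_in/Uq_rel_zx.
Qed.

Definition calA_pred : {pred U} := even_span Ux Uy Uz.

HB.instance Definition _ := GRing.isSubalgClosed.Build K U calA_pred
  (even_span_subalg_closed q_neq0 qqi_neq0 Uxy Uyz Uzx).

(* The even part of U_q(sl_2), as a K-algebra in its own right. *)
Record calA := CalA { calA_val : U; _ : calA_val \in calA_pred }.

HB.instance Definition _ := [isSub for calA_val].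
HB.instance Definition _ := [Choice of calA by <:].
HB.instance Definition _ := [SubChoice_isSubAlgebra of calA by <:].

End Uq.

Section LMatrices.
Variables (K : fieldType) (q : K).
Hypothesis q_neq0 : q != 0.
Variable d : nat.

Definition Ltheta (i : nat) : K := q ^ (d%:Z - (2 * i)%N%:Z).
Definition Llower (i : nat) : K := q ^ (- d%:Z) - q ^ (d%:Z - (2 * i)%N%:Z + 2%:Z).
Definition Lraise (i : nat) : K := q ^ d%:Z - q ^ (d%:Z - (2 * i)%N%:Z - 2%:Z).

(* Matrices of x, y, z on L(d,1) in the basis u_0, ..., u_d: column i holds the
   coordinates of the image of u_i. The conventions u_(-1) = u_(d+1) = 0 amount
   to there being no such row. *)
Definition Lx_mx : 'M[K]_d.+1 := \matrix_(j, i)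
  (Ltheta i *+ (j == i :> nat) + Llower i *+ (j.+1 == i :> nat)).
Definition Ly_mx : 'M[K]_d.+1 := \matrix_(j, i)
  (Ltheta i *+ (j == i :> nat) + Lraise i *+ (j == i.+1 :> nat)).
Definition Lz_mx : 'M[K]_d.+1 := \matrix_(j, i)
  (q ^ ((2 * i)%N%:Z - d%:Z) *+ (j == i :> nat)).

Let D := q ^+ d.
Let W i := q ^- (2 * i).

Let D0 : D != 0. Proof. by rewrite expf_neq0. Qed.
Let W0 i : W i != 0. Proof. by rewrite invr_eq0 expf_neq0. Qed.
Let WS i : W i.+1 = W i / q ^+ 2.
Proof. by rewrite /W mulnS exprD invfM mulrC. Qed.

Let thE i : Ltheta i = D * W i.
Proof. by rewrite /Ltheta expfzDr // -!exprnN. Qed.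
Let loE i : Llower i = D^-1 - D * W i * q ^+ 2.
Proof. by rewrite /Llower !expfzDr // -!exprnN. Qed.
Let raE i : Lraise i = D - D * W i / q ^+ 2.
Proof. by rewrite /Lraise !expfzDr // -!exprnN. Qed.
Let zeE i : q ^ ((2 * i)%N%:Z - d%:Z) = (W i)^-1 / D.
Proof. by rewrite expfzDr // -exprnN invrK. Qed.


Let Lsum (M : 'M[K]_d.+1) (m : nat -> nat -> K) (c : K) (h : nat) i :
    (forall k i, M k i = m k i) ->
  \sum_(k < d.+1) (c *+ (h == k :> nat)) * M k i =
  if (h < d.+1)%N then c * m h i else 0.
Proof.
move=> Mm; case: ifPn => hd; last first.
  rewrite big1 // => k _; case: eqP => [hk|]; last by rewrite mul0r.
  by rewrite hk ltn_ord in hd.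
rewrite (bigD1 (Ordinal hd)) //= eqxx Mm big1 ?addr0 // => k.
by rewrite -val_eqE eq_sym /= => /negbTE->; rewrite mul0r.
Qed.

Let lx (j i : nat) : K := Ltheta i *+ (j == i) + Llower i *+ (j.+1 == i).
Let ly (j i : nat) : K := Ltheta i *+ (j == i) + Lraise i *+ (j == i.+1).
Let lz (j i : nat) : K := (q ^ ((2 * i)%N%:Z - d%:Z)) *+ (j == i).

Let Lx_mul (M : 'M[K]_d.+1) (m : nat -> nat -> K) (j i : 'I_d.+1) :
    (forall k i : 'I_d.+1, M k i = m k i) ->
  (Lx_mx *m M) j i = Ltheta j * m j i + Llower j.+1 * m j.+1 i.
Proof.
move=> Mm; rewrite mxE.
have -> : Ltheta j * m j i = if (j < d.+1)%N then Ltheta j * m j i else 0.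
  by rewrite ltn_ord.
have -> : Llower j.+1 * m j.+1 i =
    if (j.+1 < d.+1)%N then Llower j.+1 * m j.+1 i else 0.
  case: ifPn => //; rewrite ltnS -leqNgt => dj; have jd : j = d :> nat.
    by apply/eqP; rewrite eqn_leq dj -ltnS ltn_ord.
  rewrite loE /W mulnS mulnC muln2 -addnn jd !exprD -/D.
  by rewrite [X in _ - X](_ : _ = D^-1) ?subrr ?mul0r //; field; rewrite D0 q_neq0.
rewrite -!(Lsum _ _ _ Mm) -big_split; apply: eq_bigr => k _ /=.
rewrite mxE mulrDl; congr (_ * _ + _ * _).
  by case: eqP => [->|].
by case: eqP => [->|].
Qed.

Let Ly_mul (M : 'M[K]_d.+1) (m : nat -> nat -> K) (j i : 'I_d.+1) :
    (forall k i : 'I_d.+1, M k i = m k i) ->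
  (Ly_mx *m M) j i = Ltheta j * m j i + (Lraise j.-1 * m j.-1 i) *+ (0 < j)%N.
Proof.
move=> Mm; rewrite mxE.
have -> : Ltheta j * m j i = if (j < d.+1)%N then Ltheta j * m j i else 0.
  by rewrite ltn_ord.
have -> : (Lraise j.-1 * m j.-1 i) *+ (0 < j)%N =
    if (j.-1 < d.+1)%N then (Lraise j.-1 *+ (0 < j)%N) * m j.-1 i else 0.
  by rewrite (leq_ltn_trans (leq_pred _) (ltn_ord _)) mulrnAl.
rewrite -!(Lsum _ _ _ Mm) -big_split; apply: eq_bigr => k _ /=.
rewrite mxE mulrDl; congr (_ * _ + _ * _).
  by case: eqP => [->|].
case: (val j) => [|j'] /=; first by rewrite mul0rn.
by rewrite eqSS; case: eqP => [->|].
Qed.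

Let Lz_mul (M : 'M[K]_d.+1) (m : nat -> nat -> K) (j i : 'I_d.+1) :
    (forall k i : 'I_d.+1, M k i = m k i) ->
  (Lz_mx *m M) j i = (W j)^-1 / D * m j i.
Proof.
move=> Mm; rewrite mxE.
have -> : (W j)^-1 / D * m j i =
    if (j < d.+1)%N then (W j)^-1 / D * m j i else 0 by rewrite ltn_ord.
rewrite -(Lsum _ _ _ Mm); apply: eq_bigr => k _ /=.
by rewrite mxE zeE; case: eqP => [->|].
Qed.

Let LxE (j i : 'I_d.+1) : Lx_mx j i = lx j i. Proof. by rewrite mxE. Qed.
Let LyE (j i : 'I_d.+1) : Ly_mx j i = ly j i. Proof. by rewrite mxE. Qed.
Let LzE (j i : 'I_d.+1) : Lz_mx j i = lz j i. Proof. by rewrite mxE. Qed.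

Variant near_spec (j i : nat) : bool -> bool -> bool -> Prop :=
| Near_eq of j = i : near_spec j i true false false
| Near_up of j = i.+1 : near_spec j i false true false
| Near_down of j.+1 = i : near_spec j i false false true
| Near_far : near_spec j i false false false.

Let nearP j i : near_spec j i (j == i) (j == i.+1) (j.+1 == i).
Proof.
case: eqP => [->|ne]; first by rewrite (ltn_eqF (ltnSn i)) (gtn_eqF (ltnSn i)); constructor.
case: eqP => [ji|ne']; last by case: eqP => ?; constructor.
by rewrite ji (gtn_eqF (leqW (ltnSn i))); constructor.
Qed.

Hypothesis qqi0 : q - q^-1 != 0.

Let qcommE (M N : 'M[K]_d.+1) :
  (forall j i, q * (M *m N) j i - q^-1 * (N *m M) j i = (q - q^-1) *+ (j == i)) ->
  qcomm q M N = 1.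
Proof.
move=> MN; apply/matrixP => j i; apply: (mulfI qqi0).
rewrite /qcomm; rewrite !mxE mulrA divff // mul1r -[X in _ = _ * X]/(_ *+ _).
by rewrite mulr_natr -MN !mxE.
Qed.

Lemma Lxy : qcomm q Lx_mx Ly_mx = 1.
Proof.
apply: qcommE => j i; rewrite (Lx_mul _ _ LyE) (Ly_mul _ _ LxE) /lx /ly.
rewrite -val_eqE /= !eqSS.
case: (nat_of_ord j) => [|k] /=; rewrite ?eqSS.
  case: (nat_of_ord i) => [|[|l]] /=;
    rewrite !(mulr0n, mulr1n, addr0, add0r, mulr0, subr0, oppr0) // ?(thE, loE, raE, WS).
    have -> : W 0 = 1 by rewrite /W invr1.
    by move: D D0 => D' D'0; field; rewrite ?D'0 ?q_neq0.
  move: (W 0) (W0 0) D D0 => w w0 D' D'0; field; rewrite ?D'0 ?q_neq0 ?w0 //.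
rewrite -[k == i]eqSS; case: (nearP k.+1 i) => [<-|[<-]|<-|];
  rewrite !(mulr0n, mulr1n, addr0, add0r, mulr0, subr0, oppr0) // ?(thE, loE, raE, WS);
  move: (W k) (W0 k) D D0 => w w0 D' D'0; by field; rewrite ?D'0 ?q_neq0 ?w0.
Qed.

Lemma Lyz : qcomm q Ly_mx Lz_mx = 1.
Proof.
apply: qcommE => j i; rewrite (Lz_mul _ _ LyE) (Ly_mul _ _ LzE) /ly /lz.
rewrite -val_eqE /= !zeE.
case: (nat_of_ord j) => [|k] /=; rewrite ?eqSS.
  case: (nat_of_ord i) => [|l] /=;
    rewrite !(mulr0n, mulr1n, addr0, add0r, mulr0, subr0, oppr0) // ?(thE, loE, raE, WS).
  by move: (W 0) (W0 0) D D0 => w w0 D' D'0; field; rewrite ?D'0 ?q_neq0 ?w0.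
rewrite -[k == i]eqSS; case: (nearP k.+1 i) => [<-|[<-]|_|];
  rewrite !(mulr0n, mulr1n, addr0, add0r, mulr0, subr0, oppr0) // ?(thE, loE, raE, WS);
  move: (W k) (W0 k) D D0 => w w0 D' D'0; by field; rewrite ?D'0 ?q_neq0 ?w0.
Qed.

Lemma Lzx : qcomm q Lz_mx Lx_mx = 1.
Proof.
apply: qcommE => j i; rewrite (Lz_mul _ _ LxE) (Lx_mul _ _ LzE) /lx /lz.
rewrite -val_eqE /= !zeE.
case: (nearP j i) => [<-|_|<-|];
  rewrite !(mulr0n, mulr1n, addr0, add0r, mulr0, subr0, oppr0) // ?(thE, loE, raE, WS);
  move: (W j) (W0 j) D D0 => w w0 D' D'0; by field; rewrite ?D'0 ?q_neq0 ?w0.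
Qed.

Lemma Ly_unit : Ly_mx \in unitmx.
Proof.
have trig : is_trig_mx Ly_mx.
  apply/is_trig_mxP => j i ji; rewrite LyE /ly (ltn_eqF ji).
  by rewrite (ltn_eqF (leqW ji)) !mulr0n addr0.
rewrite unitmxE det_trig // unitfE prodf_seq_neq0; apply/allP => i _ /=.
by rewrite LyE /ly eqxx (ltn_eqF (ltnSn i)) mulr0n addr0 thE mulf_neq0.
Qed.

End LMatrices.

Section LModule.
Variables (K : fieldType) (q : K).
Hypotheses (q_neq0 : q != 0) (q_nroot : ~ is_root_of_unity q).
Local Notation U := (Uq q_neq0 q_nroot).
Variables (d : nat) (b : bool).

(* epsilon: 1 for b = false, -1 for b = true. *)
Definition Lsign : K := (-1) ^+ b.

Lemma Lsign2 : Lsign * Lsign = 1.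
Proof. by rewrite /Lsign -expr2 sqrr_sign. Qed.

Definition Lgens : 'I_4 -> 'M[K]_d.+1 := gens4
  (Lsign *: Lx_mx q d) (Lsign *: Ly_mx q d)
  (Lsign *: invmx (Ly_mx q d)) (Lsign *: Lz_mx q d).

Let qcomm_sign (x y : 'M[K]_d.+1) : qcomm q x y = 1 ->
  qcomm q (Lsign *: x) (Lsign *: y) = 1.
Proof.
by rewrite /qcomm -!scalerAl -!scalerAr !(scalerA Lsign) Lsign2 !scale1r.
Qed.

Lemma Lgens_rel f : ideal_gen (Uq_rel q) f -> free_eval Lgens f = 0.
Proof.
have qqi0 := qqi_neq0 q_neq0 q_nroot.
apply: free_eval_Uq_rel; try apply: qcomm_sign.
- rewrite -scalerAl -scalerAr scalerA Lsign2 scale1r.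
  exact: mulmxV (Ly_unit q_neq0 d).
- rewrite -scalerAl -scalerAr scalerA Lsign2 scale1r.
  exact: mulVmx (Ly_unit q_neq0 d).
- exact: Lxy.
- exact: Lyz.
- exact: Lzx.
Qed.

Definition Lrho : U -> 'M[K]_d.+1 := quot_lift (free_eval Lgens).

Fact Lrho_zmod_morphism : zmod_morphism Lrho.
Proof. by apply: quot_liftB Lgens_rel; apply: free_evalB. Qed.

Fact Lrho_monoid_morphism : monoid_morphism Lrho.
Proof.
split.
  by apply: quot_lift1 Lgens_rel; [apply: free_evalB|apply: free_eval1].
by apply: quot_liftM Lgens_rel; [apply: free_evalB|apply: free_evalM].
Qed.

Fact Lrho_scalable : scalable Lrho.
Proof. by apply: quot_liftZ Lgens_rel; [apply: free_evalB|apply: free_evalZ]. Qed.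

HB.instance Definition _ :=
  GRing.isZmodMorphism.Build U 'M[K]_d.+1 Lrho Lrho_zmod_morphism.
HB.instance Definition _ :=
  GRing.isMonoidMorphism.Build U 'M[K]_d.+1 Lrho Lrho_monoid_morphism.
HB.instance Definition _ :=
  GRing.isScalable.Build K U 'M[K]_d.+1 *:%R Lrho Lrho_scalable.

(* L(d,epsilon); the defining formulas are Leps_x, Leps_y, Leps_z below. *)
Definition Leps : lmodType U := rep_module Lrho.

Let Lrho_gen i : Lrho (quot_proj (Uq_rel_proper q_neq0 q_nroot) (gen K i)) = Lgens i.
Proof.
apply: etrans (free_eval_gen _ _).
by apply: quot_lift_proj Lgens_rel _; apply: free_evalB.
Qed.

Lemma Lrho_x : Lrho (Ux q_neq0 q_nroot) = Lsign *: Lx_mx q d.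
Proof. exact: Lrho_gen. Qed.
Lemma Lrho_y : Lrho (Uy q_neq0 q_nroot) = Lsign *: Ly_mx q d.
Proof. exact: Lrho_gen. Qed.
Lemma Lrho_z : Lrho (Uz q_neq0 q_nroot) = Lsign *: Lz_mx q d.
Proof. exact: Lrho_gen. Qed.

(* The basis vector u_i for 0 <= i <= d, and 0 for every other integer i. *)
Definition Lu (i : int) : Leps := (\col_(j < d.+1) (j%:Z == i)%:R : 'cV[K]_d.+1).

Let Lact (m : 'M[K]_d.+1) (a : U) (c : K) i j : Lrho a = Lsign *: m ->
  ((Lsign *: a - c%:A) *: Lu i : 'cV_d.+1) j 0
  = \sum_(k < d.+1) m j k * (k%:Z == i)%:R - c * (j%:Z == i)%:R.
Proof.
move=> am.
transitivity ((Lrho (Lsign *: a - c%:A) *m (Lu i : 'cV_d.+1)) j 0); first by [].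
have -> : Lrho (Lsign *: a - c%:A) = m - c%:M.
  rewrite Lrho_zmod_morphism.
  congr (_ - _); last by rewrite Lrho_scalable rmorph1 scalemx1.
  by rewrite Lrho_scalable am scalerA Lsign2 scale1r.
rewrite mulmxBl mul_scalar_mx !mxE; congr (_ - _).
by apply: eq_bigr => k _; rewrite mxE.
Qed.

Let Lpick (m : 'M[K]_d.+1) (i j : 'I_d.+1) :
  \sum_(k < d.+1) m j k * (k%:Z == i%:Z)%:R = m j i.
Proof.
rewrite (bigD1 i) //= eqxx mulr1 big1 ?addr0 // => k /negbTE.
by rewrite -val_eqE /= => ki; rewrite eqz_nat ki mulr0.
Qed.

Let Lscale (c : K) (i : int) (j : 'I_d.+1) :
  (c%:A *: Lu i : 'cV_d.+1) j 0 = c * (j%:Z == i)%:R.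
Proof.
transitivity ((Lrho (c%:A : U) *m (Lu i : 'cV_d.+1)) j 0); first by [].
by rewrite Lrho_scalable rmorph1 -scalemxAl mul1mx !mxE.
Qed.

Lemma Leps_x (i : 'I_d.+1) :
  (Lsign *: Ux q_neq0 q_nroot - (q ^ (d%:Z - 2 * i%:Z))%:A) *: Lu i =
  (q ^ (- d%:Z) - q ^ (d%:Z - 2 * i%:Z + 2))%:A *: Lu (i%:Z - 1).
Proof.
apply/matrixP => j k; rewrite ord1 {k} (Lact _ _ _ Lrho_x) Lpick Lscale mxE.
rewrite eqz_nat mulr_natr addrAC subrr add0r mulr_natr.
by rewrite /Llower PoszM; congr (_ *+ _); apply/eqP/eqP; lia.
Qed.

Lemma Leps_y (i : 'I_d.+1) :
  (Lsign *: Uy q_neq0 q_nroot - (q ^ (d%:Z - 2 * i%:Z))%:A) *: Lu i =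
  (q ^ d%:Z - q ^ (d%:Z - 2 * i%:Z - 2))%:A *: Lu (i%:Z + 1).
Proof.
apply/matrixP => j k; rewrite ord1 {k} (Lact _ _ _ Lrho_y) Lpick Lscale mxE.
rewrite eqz_nat mulr_natr addrAC subrr add0r mulr_natr.
by rewrite /Lraise PoszM; congr (_ *+ _); apply/eqP/eqP; lia.
Qed.

Lemma Leps_z (i : 'I_d.+1) :
  (Lsign *: Uz q_neq0 q_nroot) *: Lu i = (q ^ (2 * i%:Z - d%:Z))%:A *: Lu i.
Proof.
apply/matrixP => j k; rewrite ord1 {k} [RHS]Lscale.
transitivity ((Lrho (Lsign *: Uz q_neq0 q_nroot) *m (Lu i : 'cV_d.+1)) j 0).
  by [].
rewrite Lrho_scalable Lrho_z scalerA Lsign2 scale1r mxE.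
under eq_bigr => l _ do rewrite [Lu _ _ _]mxE.
by rewrite Lpick mxE mulr_natr PoszM.
Qed.

End LModule.

Section L.
Variables (K : fieldType) (q : K).
Hypotheses (q_neq0 : q != 0) (q_nroot : ~ is_root_of_unity q).
Variable d : nat.

(* L(d): the restriction of L(d,1) to calA. *)
Definition L : lmodType (calA q_neq0 q_nroot) :=
  restr_scalars \val (Leps q_neq0 q_nroot d false).

(* The restrictions of L(d,1) and L(d,-1) to calA agree under u_i |-> u_i. *)
Lemma Lrho_sign (a : Uq q_neq0 q_nroot) : a \in @calA_pred _ _ q_neq0 q_nroot ->
  Lrho d true a = Lrho d false a.
Proof.
rewrite unfold_in => /asboolP [s [sP ->]].
have LD (c : bool) : {morph @Lrho _ _ q_neq0 q_nroot d c : u v / u + v}.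
  by move=> u v; apply: raddfD.
have L0 (c : bool) : @Lrho _ _ q_neq0 q_nroot d c 0 = 0 by apply: raddf0.
rewrite (big_morph _ (LD true) (L0 true)) (big_morph _ (LD false) (L0 false)).
rewrite big_seq [RHS]big_seq; apply: eq_bigr => p /sP [r [t [u [o ->]]]].
rewrite !Lrho_scalable; congr (_ *: _).
have LM c : @Lrho _ _ q_neq0 q_nroot d c
    (Ux q_neq0 q_nroot ^+ r * Uy q_neq0 q_nroot ^+ t * Uz q_neq0 q_nroot ^+ u) =
    Lsign K c ^+ (r + t + u) *: (Lx_mx q d ^+ r * Ly_mx q d ^+ t * Lz_mx q d ^+ u).
  rewrite !rmorphM !rmorphXn /= Lrho_x Lrho_y Lrho_z !exprZn.
  rewrite -!scalerAl -!scalerAr -!scalerAl !scalerA; congr (_ *: _).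
  by rewrite !exprD; ring.
by rewrite !LM /Lsign expr0 expr1n expr1 -signr_odd (negbTE o).
Qed.
End L.

(* Main.v *)
Require Import Defs.
From mathcomp Require Import all_boot all_order all_algebra.
From mathcomp Require Import boolp zify.

Set Implicit Arguments.
Unset Strict Implicit.
Unset Printing Implicit Defensive.

Import GRing.Theory.
Local Open Scope ring_scope.

(** The element z^2 of calA acts diagonally on the basis u_0, ..., u_d, with
    eigenvalues q^(4i-2d) that are pairwise distinct because q is not a root of
    unity.  Hence a submodule contains u_i as soon as one of its vectors has a
    nonzero i-th coordinate ([delta_in_stable]).  The elements xz and yz of calA
    send u_i to a combination of u_i and u_(i-1), respectively of u_i and
    u_(i+1).  The coefficient of the neighbour is a power of q times
    q^(-d) - q^(d-2i+2), which vanishes only for i = d + 1, respectively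
    q^d - q^(d-2i-2), which vanishes only for i = -1.  So from one basis vector
    the submodule reaches all of them, and a nonzero submodule is everything
    ([adjacent_stable_full]). *)

Section DiagonalStable.
Context {K : fieldType} {n : nat}.
Variables (lam : 'rV[K]_n) (W : {pred 'cV[K]_n}).
Hypothesis lam_inj : injective (lam 0).
Hypothesis W_submod : submod_closed W.

Let stable (M : 'M[K]_n) := forall v, v \in W -> M *m v \in W.

Hypothesis W_lam : stable (diag_mx lam).

Let WZ c v : v \in W -> c *: v \in W.
Proof. by case: W_submod => W0 WD Wv; rewrite -[c *: v]addr0 WD. Qed.

Let WD c u v : u \in W -> v \in W -> c *: u + v \in W.
Proof. by case: W_submod => _; apply. Qed.

(** Subtracting lam j from the diagonal action kills the j-th coordinate and
    rescales the others; doing so for every j in a list gives this product. *)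
Lemma prod_diag_stable (s : seq 'I_n) v : v \in W ->
  (\col_i ((\prod_(j <- s) (lam 0 i - lam 0 j)) * v i 0)) \in W.
Proof.
move=> Wv; elim: s => [|j s IHs].
  rewrite (_ : \col_i _ = v) //; apply/colP => i.
  by rewrite mxE big_nil mul1r.
move: (WD (- lam 0 j) IHs (W_lam IHs)); congr (_ \in W); apply/colP => i.
by rewrite mul_diag_mx !mxE big_cons -mulrA mulrBl mulNr addrC.
Qed.

(** Interpolation: killing every coordinate but the i-th isolates a nonzero
    multiple of the basis vector, since the eigenvalues are distinct. *)
Lemma delta_in_stable v i : v \in W -> v i 0 != 0 -> delta_mx i 0 \in W.
Proof.
move=> /(prod_diag_stable [seq j <- enum 'I_n | j != i]); set u := \col__ _.
set c := \prod_(j <- [seq j <- enum 'I_n | j != i]) (lam 0 i - lam 0 j).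
move=> Wu vi; have c0 : c != 0.
  rewrite prodf_seq_neq0; apply/allP => j; rewrite mem_filter => /andP[ji _] /=.
  by rewrite subr_eq0 (inj_eq lam_inj) eq_sym.
have -> : delta_mx i 0 = (c * v i 0)^-1 *: u; last exact: WZ.
apply/colP => k; rewrite !mxE eqxx andbT.
have [->|ki] := eqVneq k i; first by rewrite mulVf // mulf_neq0.
rewrite (big_rem k) /=; last by rewrite mem_filter ki mem_enum.
by rewrite subrr !mul0r mulr0.
Qed.

Lemma delta_step (M : 'M[K]_n) i j : stable M -> M j i != 0 ->
  delta_mx i 0 \in W -> delta_mx j 0 \in W.
Proof.
move=> WM Mji Wi; apply: (delta_in_stable (v := M *m delta_mx i 0)).
  exact: WM.
by rewrite -colE mxE.
Qed.

Lemma deltas_full : (forall i, delta_mx i 0 \in W) -> forall v, v \in W.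
Proof.
case: W_submod => W0 _ Wd v.
rewrite (matrix_sum_delta v) (big_ind (fun u => u \in W)) // => [u w Wu Ww|i _].
  by rewrite -[u]scale1r; apply: WD.
by rewrite big_ord1; apply: WZ.
Qed.

End DiagonalStable.

(** Any nonzero vector yields some basis vector; [Dn] then walks down to the
    first one and [Up] walks up to all the others.  Their columns may have other
    nonzero entries, such as the diagonal ones of xz and yz, because the
    diagonal matrix isolates each coordinate of the image. *)
Lemma adjacent_stable_full {K : fieldType} {d : nat} (lam : 'rV[K]_d.+1)
    (Dn Up : 'M[K]_d.+1) (W : {pred 'cV[K]_d.+1}) :
  injective (lam 0) -> submod_closed W ->
  (forall M, M \in [:: diag_mx lam; Dn; Up] -> forall v, v \in W -> M *m v \in W) ->
  (forall j i : 'I_d.+1, i = j.+1 :> nat -> Dn j i != 0) ->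
  (forall j i : 'I_d.+1, j = i.+1 :> nat -> Up j i != 0) ->
  (forall v, v \in W -> v = 0) \/ (forall v, v \in W).
Proof.
move=> lam_inj Wsub WM Dn0 Up0.
have Wlam : forall v, v \in W -> diag_mx lam *m v \in W.
  by apply: WM; rewrite mem_head.
have step := delta_step lam_inj Wsub Wlam.
have down (m : nat) (i : 'I_d.+1) : i = m :> nat ->
    delta_mx i 0 \in W -> delta_mx 0 0 \in W.
  elim: m i => [|m IHm] i im; first by rewrite (_ : i = 0) //; apply: val_inj.
  have md : (m < d.+1)%N by rewrite -ltnS -im (leq_trans (ltn_ord i)).
  move=> Wi; apply: (IHm (Ordinal md)) => //.
  by apply: (step Dn) Wi; [apply: WM; rewrite !inE eqxx orbT|apply: Dn0].
have up : delta_mx 0 0 \in W -> forall (m : nat) (i : 'I_d.+1), i = m :> nat ->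
    delta_mx i 0 \in W.
  move=> Wz; elim=> [|m IHm] i im; first by rewrite (_ : i = 0) //; apply: val_inj.
  have md : (m < d.+1)%N by rewrite -ltnS -im (leq_trans (ltn_ord i)).
  have := IHm (Ordinal md) erefl.
  by apply: (step Up); [apply: WM; rewrite !inE eqxx !orbT|apply: Up0].
have [Wz|Wz] := boolP (delta_mx 0 0 \in W); [right|left].
  by apply: deltas_full => // i; apply: (up Wz i).
move=> v Wv; apply/colP => i; rewrite [RHS]mxE; apply/eqP.
apply: contraNT Wz => vi; apply: (down i i) => //.
exact: (delta_in_stable lam_inj Wsub Wlam Wv).
Qed.

Section EvenAction.
Variables (K : fieldType) (q : K).
Hypotheses (q_neq0 : q != 0) (q_nroot : ~ is_root_of_unity q).
Variable d : nat.

Lemma expfz_inj_nroot : injective (fun m : int => q ^ m).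
Proof.
have q1 (n : nat) : (0 < n)%N -> q ^ n%:Z <> 1.
  by move=> n0 /eqP; apply/negP; apply: (qn_neq1 q_nroot).
move=> m m' /= mm'; apply/eqP; rewrite -subr_eq0; apply/negPn/negP => ne.
have : q ^ (m - m') = 1 by rewrite expfzDr // mm' -expfzDr // subrr.
case: (m - m') ne => [[|n]|n] // _; first exact: q1.
rewrite NegzE -exprnN => /(congr1 GRing.inv); rewrite invrK invr1.
exact: q1.
Qed.

Let zexp : 'rV[K]_d.+1 := \row_i q ^ ((2 * i)%N%:Z - d%:Z).

Lemma Lz_diag : Lz_mx q d = diag_mx zexp.
Proof. by apply/matrixP => j i; rewrite !mxE -val_eqE; case: eqP => [->|]. Qed.

Lemma Lz2_diag :
  Lz_mx q d *m Lz_mx q d = diag_mx (\row_i q ^ (2 * ((2 * i)%N%:Z - d%:Z))).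
Proof.
rewrite Lz_diag mulmx_diag; congr diag_mx; apply/rowP => i; rewrite !mxE.
by rewrite -expfzDr // mulr2n mulrDl mul1r.
Qed.

Lemma Lz2_inj :
  injective ((\row_(i < d.+1) q ^ (2 * ((2 * i)%N%:Z - d%:Z))) 0).
Proof.
move=> i j; rewrite !mxE => /expfz_inj_nroot ij; apply: val_inj => /=; lia.
Qed.

Lemma Lxz_lower (j i : 'I_d.+1) : i = j.+1 :> nat ->
  (Lx_mx q d *m Lz_mx q d) j i != 0.
Proof.
move=> ij; rewrite Lz_diag mul_mx_diag !mxE ij eqxx.
rewrite (ltn_eqF (ltnSn j)) add0r mulf_neq0 ?expfz_neq0 //.
rewrite /Llower subr_eq0 (inj_eq expfz_inj_nroot).
have := ltn_ord i; lia.
Qed.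

Lemma Lyz_raise (j i : 'I_d.+1) : j = i.+1 :> nat ->
  (Ly_mx q d *m Lz_mx q d) j i != 0.
Proof.
move=> ji; rewrite Lz_diag mul_mx_diag !mxE ji eqxx.
rewrite (gtn_eqF (ltnSn i)) add0r mulf_neq0 ?expfz_neq0 //.
rewrite /Lraise subr_eq0 (inj_eq expfz_inj_nroot); lia.
Qed.

Lemma even_monomial_calA r s t : ~~ odd (r + s + t) ->
  Ux q_neq0 q_nroot ^+ r * Uy q_neq0 q_nroot ^+ s * Uz q_neq0 q_nroot ^+ t
    \in @calA_pred _ _ q_neq0 q_nroot.
Proof.
by move=> o; rewrite unfold_in; apply/asboolP/span_in; exists r, s, t.
Qed.

Lemma submod_even_monomial (W : {pred L q_neq0 q_nroot d}) r s t
    (v : 'cV[K]_d.+1) : submod_closed W -> ~~ odd (r + s + t) ->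
  v \in (W : {pred 'cV[K]_d.+1}) ->
  (Lx_mx q d ^+ r * Ly_mx q d ^+ s * Lz_mx q d ^+ t) *m v
    \in (W : {pred 'cV[K]_d.+1}).
Proof.
move=> [W0 WD] o Wv.
have := WD (CalA (even_monomial_calA o)) v 0 Wv W0; rewrite addr0.
rewrite restr_scaleE rep_scaleE /= !rmorphM !rmorphXn /=.
by rewrite Lrho_x Lrho_y Lrho_z /Lsign expr0 !scale1r.
Qed.

(** A submodule is a K-subspace because calA contains the multiples of 1. *)
Lemma submod_subspace (W : {pred L q_neq0 q_nroot d}) :
  submod_closed W -> submod_closed (W : {pred 'cV[K]_d.+1}).
Proof.
move=> [W0 WD]; split=> // c u v Wu Wv.
have := WD c%:A u v Wu Wv; congr (_ \in W); congr (_ + _).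
rewrite restr_scaleE rep_scaleE /=.
by rewrite linearZ rmorph1 -scalemxAl mul1mx.
Qed.

End EvenAction.

Theorem lemma7p3 (K : fieldType) (q : K) (q_neq0 : q != 0)
    (q_nroot : ~ is_root_of_unity q) (d : nat) :
  irreducible_module (L q_neq0 q_nroot d).
Proof.
split.
  exists (const_mx 1 : 'cV[K]_d.+1); apply/eqP => /(congr1 (fun v : 'cV[K]_d.+1 => v 0 0)).
  by rewrite !mxE => /eqP; rewrite oner_eq0.
move=> W Wsub; have Wmono := fun r s t v => submod_even_monomial (r := r) (s := s) (t := t) (v := v) Wsub.
apply: (adjacent_stable_full (Dn := Lx_mx q d *m Lz_mx q d)
  (Up := Ly_mx q d *m Lz_mx q d)
  (Lz2_inj q_neq0 q_nroot (d := d)) (submod_subspace Wsub)).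
- move=> M; rewrite !inE -Lz2_diag // => /or3P[] /eqP-> v Wv.
  + by have := Wmono 0 0 2 v isT Wv; rewrite !expr0 !mul1r.
  + by have := Wmono 1 0 1 v isT Wv; rewrite !expr0 !expr1 mulr1.
  + by have := Wmono 0 1 1 v isT Wv; rewrite !expr0 !expr1 mul1r.
- by move=> j i; apply: Lxz_lower.
- by move=> j i; apply: Lyz_raise.
Qed.
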